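(* Let $\mathbb{F}$ be a field and $n$ a positive integer. Then the length of the algebra $\mathcal{C}_n(\mathbb{F})$ of bicirculants of order $n$ over $\mathbb{F}$ is $$l(\mathcal{C}_n(\mathbb{F}))=n-1.$$
   Context: Let $\mathcal{A}$ be an associative finite-dimensional algebra with identity $1_{\mathcal{A}}$ over a field $\mathbb{F}$. For a finite subset $\mathcal{S}\subset\mathcal{A}$ and $i\ge 0$, $\mathcal{L}_i(\mathcal{S})$ denotes the $\mathbb{F}$-linear span of all products of at most $i$ elements of $\mathcal{S}$ (repetitions allowed), where the empty product is $1_{\mathcal{A}}$. Put $\mathcal{L}(\mathcal{S})=\bigcup_{i\ge 0}\mathcal{L}_i(\mathcal{S})$. The set $\mathcal{S}$ is a generating set of $\mathcal{A}$ if $\mathcal{L}(\mathcal{S})=\mathcal{A}$. The length of a generating set $\mathcal{S}$ is $l(\mathcal{S})=\min\{k\in\mathbb{Z}_{\ge 0}:\mathcal{L}_k(\mathcal{S})=\mathcal{A}\}$, and the length of the algebra is $l(\mathcal{A})=\max\{l(\mathcal{S}):\mathcal{L}(\mathcal{S})=\mathcal{A}\}$. Let $E_{i,j}$ denote the matrix units in $M_n(\mathbb{F})$. Let $A_n=E_{n,1}+E_{1,2}+E_{2,3}+\cdots+E_{n-1,n}$ (the cyclic permutation matrix) and $B_n=E_{1,n}+E_{2,n-1}+\cdots+E_{n,1}$ (the matrix with ones on the anti-diagonal and zeros elsewhere). The algebra of bicirculants of order $n$ over $\mathbb{F}$ is $\mathcal{C}_n(\mathbb{F})=\mathcal{L}(\{A_n,B_n\})\subseteq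 M_n(\mathbb{F})$, i.e. the unital subalgebra of $M_n(\mathbb{F})$ generated by $A_n$ and $B_n$. *)

(* Defs.v *)
From HB Require Import structures.
From mathcomp Require Import all_boot all_order all_algebra all_field.
From mathcomp Require Import finmap.
Set Implicit Arguments.
Unset Strict Implicit.
Unset Printing Implicit Defensive.
Import GRing.Theory.
Local Open Scope ring_scope.
Local Open Scope fset_scope.

Section Length.
Variables (F : fieldType) (A : falgType F).

(* [i.-bseq S] is the finite type of words of length at most [i] in the letters
   of [S]; the empty word contributes the product [1]. *)
Definition Lspan (i : nat) (S : {fset A}) : {vspace A} :=
  <<[seq \prod_(x <- w) val x | w : i.-bseq S]>>%VS.

Definition generating (S : {fset A}) : Prop :=
  forall a : A, exists i, a \in Lspan i S.

(* [set_length S k] reads l(S) = k. *)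
Definition set_length (S : {fset A}) (k : nat) : Prop :=
  Lspan k S = fullv /\ (forall j, Lspan j S = fullv -> (k <= j)%N).

(* [algebra_length l] reads l(A) = l: the maximum of l(S) over all generating
   sets S exists and is equal to l. *)
Definition algebra_length (l : nat) : Prop :=
  (exists2 S : {fset A}, generating S & set_length S l) /\
  (forall S : {fset A}, generating S ->
     exists2 k, set_length S k & (k <= l)%N).

Lemma Lspan_mem (i : nat) (S : {fset A}) (w : seq A) :
  {subset w <= S} -> (size w <= i)%N -> \prod_(x <- w) x \in Lspan i S.
Proof.
move=> wS wi; apply: memv_span.
have sz : (size (pmap (insub : A -> option S) w) <= i)%N.
  by rewrite (leq_trans _ wi) // size_pmap count_size.
apply/imageP; exists (Bseq sz) => //=.
rewrite -(big_map val xpredT id) /= pmap_filter; last exact: insubK.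
rewrite (eq_in_filter (a2 := predT)) ?filter_predT // => x /wS xS /=.
by rewrite insubT.
Qed.

Lemma Lspan_sub (i j : nat) (S : {fset A}) :
  (i <= j)%N -> (Lspan i S <= Lspan j S)%VS.
Proof.
move=> ij; apply/span_subvP => _ /imageP[w _ ->].
rewrite -(big_map val xpredT id); apply: Lspan_mem.
  by move=> _ /mapP[x _ ->]; exact: valP.
by rewrite size_map (leq_trans (size_bseq w)).
Qed.

(* The union of the L_i(S) is the unital subalgebra generated by S. *)
Lemma mem_agenv_Lspan (S : {fset A}) (v : A) :
  (v \in agenv <<S>>%VS) <-> (exists i, v \in Lspan i S).
Proof.
split=> [|[i]]; last first.
  move: v; apply/subvP/span_subvP => _ /imageP[w _ ->].
  elim: (val w) => [|x s IH].
    by rewrite big_nil memvE sub1_agenv.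
  have x_in : val x \in agenv <<S>>%VS.
    by apply: (subvP (sub_agenv _)); apply: memv_span; exact: valP.
  by rewrite big_cons; have := memv_mul x_in IH; rewrite agenvM.
rewrite /agenv; set n := \dim _ => v_in; exists n; move: v v_in.
apply/subvP/subv_sumP => i _.
apply: (@subv_trans _ _ (Lspan i S)); last by rewrite Lspan_sub // ltnW.
move: (nat_of_ord i) => {n i}; elim=> [|k IH].
  rewrite expv0 -memvE; have := @Lspan_mem 0 S [::].
  by rewrite big_nil; apply.
rewrite expvSl; apply: (subv_trans (prodvSr _ IH)).
rewrite {1}/Lspan !span_def big_distrlr /= big_seq.
apply: (big_ind (fun V => V <= _)%VS) => [|U V ? ?|x xS]; rewrite ?sub0v //.
  by rewrite subv_add; apply/andP.
rewrite big_seq.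
apply: (big_ind (fun V => V <= _)%VS) => [|U V ? ?|_ /imageP[w _ ->]];
  rewrite ?sub0v //.
  by rewrite subv_add; apply/andP.
rewrite prodv_line -memvE -(big_map val xpredT id) /=.
have -> : x * (\prod_(y <- map val w) y) = \prod_(y <- x :: map val w) y.
  by rewrite big_cons.
apply: Lspan_mem => [y|]; last by rewrite /= size_map ltnS size_bseq.
by rewrite inE => /predU1P[-> //|/mapP[z _ ->]]; exact: valP.
Qed.

End Length.

Arguments algebra_length {F} A l.

Section Bicirculants.
Variables (F : fieldType).

(* [ordS] is the cyclic successor and [rev_ord] the reversal on ['I_n]; indices
   start from 0. *)
Definition cyclic_mx (n : nat) : 'M[F]_n :=
  \sum_(i < n) delta_mx i (ordS i).

Definition antidiag_mx (n : nat) : 'M[F]_n :=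
  \sum_(i < n) delta_mx i (rev_ord i).

(* Matrices are an algebra only in a dimension which is syntactically positive,
   hence [n.-1.+1]: the order is [n] when [0 < n]. *)
Definition bicirculants (n : nat) : {aspace 'M[F]_n.-1.+1} :=
  << <<[fset cyclic_mx n.-1.+1; antidiag_mx n.-1.+1]>>%VS >>%AS.

Lemma mem_bicirculants (n : nat) (M : 'M[F]_n.-1.+1) :
  (M \in bicirculants n) <->
  exists i, M \in Lspan i [fset cyclic_mx n.-1.+1; antidiag_mx n.-1.+1].
Proof. exact: mem_agenv_Lspan. Qed.

End Bicirculants.

(* Main.v *)
Require Import Defs.
From mathcomp Require Import all_boot all_order all_algebra all_field.
From mathcomp Require Import finmap zify.

(** Upper bound. Call a word w in S essential if its product is not in
    L_(|w|-1)(S). If dim L_k(S) grows by at most 1 at some step 0 < k < l = l(S),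
    then all essential words of length k are proportional modulo L_(k-1)(S), so
    they can be exchanged inside longer essential words. Repeatedly doubling the
    first letter yields a letter x such that x^l is essential, whence
    1, x, .., x^l are independent. If there is no such k, the algebra has
    dimension at least 2l. For bicirculants, l <= n - 1 in both cases: every x
    is a root of a polynomial of degree n (Cayley-Hamilton), and the dimension is
    at most 2n - 1, as the A^i and the A^i B span and the all-ones matrix is both
    sum_i A^i and sum_i A^i B.

    Lower bound. B and A B are the permutation matrices of two reflections of
    the n-gon. If its vertices are ordered as n-1, 0, n-2, 1, .., both move each
    vertex by at most one position, so words of length < n - 1 have a zero entry
    between the two ends of this path, where some power of A has a one. *)

Set Implicit Arguments.
Unset Strict Implicit.
Unset Printing Implicit Defensive.
Import GRing.Theory.
Local Open Scope ring_scope.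

(** * Spans of words and the exchange of essential words *)

Section LengthBound.
Variables (F : fieldType) (A : falgType F) (S : {fset A}).

Lemma Lspan_subP (k : nat) (V : {vspace A}) :
  reflect (forall w : seq A, {subset w <= S} -> (size w <= k)%N ->
             \prod_(x <- w) x \in V)
          (Lspan k S <= V)%VS.
Proof.
apply: (iffP idP) => [/subvP sV w wS wk|wV]; first exact/sV/Lspan_mem.
apply/span_subvP => _ /imageP[w _ ->].
rewrite -(big_map val xpredT id); apply: wV; last by rewrite size_map size_bseq.
by move=> _ /mapP[x _ ->]; exact: valP.
Qed.

Lemma Lspan0 : Lspan 0 S = 1%VS.
Proof.
apply/eqP; rewrite eqEsubv -memvE; apply/andP; split.
  by apply/Lspan_subP => -[|//] _ _; rewrite big_nil memv_line.
by rewrite -(big_nil 1 *%R xpredT id); exact: Lspan_mem.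
Qed.

Lemma Lspan_mul (i j : nat) (u v : A) :
  u \in Lspan i S -> v \in Lspan j S -> u * v \in Lspan (i + j) S.
Proof.
move=> ui vj; have := memv_mul ui vj; apply/subvP.
apply/prodvP => {ui vj}{}u {}v ui vj.
have /subvP/(_ _ ui) : (Lspan i S <= amulr v @^-1: Lspan (i + j) S)%VS.
  apply/Lspan_subP => w wS wi; rewrite -memv_preim lfunE /=.
  have /subvP/(_ _ vj) :
      (Lspan j S <= amull (\prod_(x <- w) x) @^-1: Lspan (i + j) S)%VS.
    apply/Lspan_subP => t tS tj; rewrite -memv_preim lfunE /= -big_cat /=.
    apply: Lspan_mem => [x|]; last by rewrite size_cat leq_add.
    by rewrite mem_cat => /orP[/wS|/tS].
  by rewrite -memv_preim lfunE.
by rewrite -memv_preim lfunE.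
Qed.

(** Since [.-1] sends 0 to 0 and [Lspan 0 S] contains 1, the empty word is never essential. *)
Definition essential (w : seq A) : Prop :=
  {subset w <= S} /\ \prod_(x <- w) x \notin Lspan (size w).-1 S.

(** A reduction of [w] to shorter words would reduce the whole word as well. *)
Lemma essential_infix (p w q : seq A) :
  (0 < size w)%N -> essential (p ++ w ++ q) -> essential w.
Proof.
move=> w0 [sub notin]; have wS : {subset w <= S}.
  by move=> x xw; apply: sub; rewrite !mem_cat xw orbT.
split=> //; apply: contra notin => w_in; rewrite !big_cat /= !size_cat.
have pS : {subset p <= S} by move=> x xp; apply: sub; rewrite !mem_cat xp.
have qS : {subset q <= S}.
  by move=> x xq; apply: sub; rewrite !mem_cat xq !orbT.
have -> : (size p + (size w + size q)).-1 =
    (size p + ((size w).-1 + size q))%N.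
  by rewrite -(prednK w0) addSn addnS.
by do 2?apply: Lspan_mul => //; exact: Lspan_mem.
Qed.

Lemma ex_essential (k : nat) :
  (0 < k)%N -> ~~ (Lspan k S <= Lspan k.-1 S)%VS ->
  exists2 w, essential w & size w = k.
Proof.
move=> k0 nsub; have /allPn[_ /imageP[w _ ->] notin] :
    ~~ all (mem (Lspan k.-1 S))
      [seq \prod_(x <- w) val x | w : k.-bseq S].
  by apply: contra nsub => /allP sub; apply/span_subvP.
move: notin; rewrite -(big_map val xpredT id) /= => notin.
have wS : {subset map val w <= S} by move=> _ /mapP[x _ ->]; exact: valP.
have sz : size (map val w) = k.
  apply/eqP; rewrite eqn_leq {1}size_map size_bseq leqNgt /=.
  apply: contra notin => lt; apply: Lspan_mem => //.
  by rewrite -ltnS (prednK k0).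
by exists (map val w) => //; split=> //; rewrite sz.
Qed.

(** By the dimension bound, [Lspan k S] is [Lspan k.-1 S] plus the line of the product of [w'].
    Hence the product of [w] is a multiple of that of [w'] up to shorter words, and reducing
    [p ++ w' ++ q] would reduce [p ++ w ++ q]. *)
Lemma essential_replace (k : nat) (p w w' q : seq A) :
  (0 < k)%N -> (\dim (Lspan k S) <= (\dim (Lspan k.-1 S)).+1)%N ->
  size w = k -> size w' = k -> essential w' ->
  essential (p ++ w ++ q) -> essential (p ++ w' ++ q).
Proof.
move=> k0 dk wk w'k [w'S w'notin] [sub notin].
have pS : {subset p <= S} by move=> x xp; apply: sub; rewrite !mem_cat xp.
have wS : {subset w <= S}.
  by move=> x xw; apply: sub; rewrite !mem_cat xw orbT.
have qS : {subset q <= S}.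
  by move=> x xq; apply: sub; rewrite !mem_cat xq !orbT.
split=> [x|]; first by rewrite !mem_cat => /or3P[/pS|/w'S|/qS].
apply: contra notin; rewrite !size_cat wk w'k !big_cat /=.
set P := \prod_(x <- p) x; set Q := \prod_(x <- q) x.
set W := \prod_(x <- w) x; set W' := \prod_(x <- w') x => in'.
have LE : (Lspan k.-1 S + <[W']>)%VS = Lspan k S.
  apply/eqP; rewrite eqEdim subv_add Lspan_sub ?leq_pred //= -memvE.
  rewrite Lspan_mem ?w'k //= (leq_trans dk) // ltnNge.
  apply: contra w'notin => le; rewrite w'k; have /eqP -> :
      Lspan k.-1 S == (Lspan k.-1 S + <[W']>)%VS by rewrite eqEdim addvSl.
  by rewrite (subvP (addvSr _ _)) ?memv_line.
have /memv_addP[u uL [_ /vlineP[c ->] ->]] : W \in (Lspan k.-1 S + <[W']>)%VS.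
  by rewrite LE Lspan_mem ?wk.
rewrite mulrDl mulrDr rpredD //; last first.
  by rewrite -scalerAl -scalerAr rpredZ.
have -> : (size p + (k + size q)).-1 = (size p + (k.-1 + size q))%N.
  by rewrite -(prednK k0) addSn addnS.
by do 2?apply: Lspan_mul => //; exact: Lspan_mem.
Qed.

(** First [nseq k x] is shown essential, working in the prefix of length [k.+1]; then the run of [x]
    swallows the rest of the word letter by letter. *)
Lemma essential_nseq (k l : nat) (v : seq A) :
  (0 < k < l)%N -> (\dim (Lspan k S) <= (\dim (Lspan k.-1 S)).+1)%N ->
  essential v -> size v = l -> exists x, essential (nseq l x).
Proof.
move=> /andP[k0 kl] dk ess_v vl.
have repl := essential_replace k0 dk.
case: v ess_v vl => [|x v] ess_v vl; first by rewrite -vl in kl.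
exists x; have ess_xk : essential (nseq k x).
  have sz : size (x :: take k v) = k.+1.
    by rewrite /= size_takel //; move: vl => /=; lia.
  have ess : essential (x :: take k v).
    apply: (@essential_infix [::] _ (drop k v)) => //=.
    by rewrite cat_take_drop.
  (* In a word of length [k.+1], the last [k] letters are replaced by the first [k]: this doubles
     the initial letter and drops the final one. *)
  suff dup i : (i <= k)%N ->
      exists2 s, size s = (k - i)%N & essential (x :: nseq i x ++ s).
    have [s] := dup k (leqnn k); rewrite subnn => /size0nil ->; rewrite cats0.
    rewrite -cat1s -{1}[nseq k x]cats0.
    by apply: essential_infix; rewrite size_nseq.
  elim: i => [_|i IH ik]; first by exists (take k v); [case: sz; lia | ].
  have [s ss ess_s] := IH (ltnW ik).
  case/lastP: s ss ess_s => [/= | s y ss ess_s]; first by lia.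
  rewrite size_rcons in ss; exists s; first by lia.
  have := repl [:: x] (nseq i x ++ rcons s y) (nseq i.+1 x ++ s) [::].
  rewrite !cats0 !cat1s; apply => //.
  - by rewrite size_cat size_nseq size_rcons; lia.
  - by rewrite size_cat size_nseq; lia.
  apply: (@essential_infix [::] _ [:: y]); first by [].
  by rewrite /= -catA cats1.
suff H s j : (k <= j)%N -> essential (nseq j x ++ s) ->
    essential (nseq (j + size s) x).
  have sz : (k + size (drop k (x :: v)))%N = l by rewrite size_drop vl; lia.
  rewrite -sz; apply: H => //; apply: (repl [::] (take k (x :: v))).
  - by rewrite size_takel // vl; lia.
  - by rewrite size_nseq.
  - by [].
  - by rewrite /= cat_take_drop.
elim: s j => [|y s IH] j kj; first by rewrite cats0 addn0.
rewrite /= addnS -addSn => ess; apply: IH; first by lia.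
(* The block made of the last [k.-1] copies of [x] and the next letter [y] is exchanged for
   [nseq k x]. *)
have nE : nseq j.+1 x = nseq (j.+1 - k) x ++ nseq k x.
  by rewrite cat_nseq /ncons -iterD subnK //; lia.
rewrite nE -catA; apply: (repl _ (rcons (nseq k.-1 x) y)) => //.
- by rewrite size_rcons size_nseq; lia.
- by rewrite size_nseq.
rewrite cat_rcons catA cat_nseq /ncons -iterD.
by have -> : (j.+1 - k + k.-1 = j)%N by lia.
Qed.

(** * Existence of the length, growth of the spans, and the upper bound *)

Lemma generating_Lspan_full : generating S -> exists k, Lspan k S = fullv.
Proof.
move=> gen; suff cover (s : seq A) : exists k, {subset s <= Lspan k S}.
  have [k full] := cover (vbasis fullv).
  exists k; apply/eqP; rewrite eqEsubv subvf -(span_basis (vbasisP fullv)).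
  exact/span_subvP.
elim: s => [|a s [k sk]]; first by exists 0%N.
have [i ai] := gen a; exists (maxn i k) => x; rewrite inE => /predU1P[->|/sk].
  by apply: subvP ai; rewrite Lspan_sub // leq_maxl.
by apply: subvP; rewrite Lspan_sub // leq_maxr.
Qed.

Lemma generating_set_length : generating S -> exists k, set_length S k.
Proof.
move=> gen; have ex : exists k, Lspan k S == fullv.
  by have [k /eqP] := generating_Lspan_full gen; exists k.
exists (ex_minn ex); case: ex_minnP => k /eqP kf kmin.
by split=> // j /eqP; exact: kmin.
Qed.

(** If one step adds nothing, peeling off first letters shows that no later step does, so the whole
    algebra is already reached at [k.-1 < l]. *)
Lemma set_length_step (k l : nat) :
  set_length S l -> (0 < k <= l)%N -> ~~ (Lspan k S <= Lspan k.-1 S)%VS.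
Proof.
move=> [lf lmin] /andP[k0 kl]; apply/negP => sub.
have stab j : (Lspan (k.-1 + j) S <= Lspan k.-1 S)%VS.
  elim: j => [|j IH]; first by rewrite addn0.
  apply/Lspan_subP => w wS wk.
  case: w wS wk => [|x w] wS wk.
    exact: (@Lspan_mem _ _ _ _ [::]).
  apply: (subvP sub); rewrite big_cons -(prednK k0) -add1n.
  apply: Lspan_mul.
    rewrite -[x](big_seq1 *%R x id); apply: Lspan_mem => // y.
    by rewrite inE => /eqP ->; apply: wS; rewrite mem_head.
  apply: (subvP IH); apply: Lspan_mem; last by move: wk; rewrite addnS.
  by move=> y yw; apply: wS; rewrite inE yw orbT.
have := lmin k.-1; suff -> : Lspan k.-1 S = fullv by move/(_ erefl); lia.
apply/eqP; rewrite eqEsubv subvf -lf /=.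
by have := stab (l - k.-1)%N; rewrite subnKC //; lia.
Qed.

Lemma set_length_bound (m l : nat) :
  (forall x : A, exists c : nat -> F, x ^+ m = \sum_(i < m) c i *: x ^+ i) ->
  set_length S l -> (l <= maxn m.-1 (\dim (fullv : {vspace A}))./2)%N.
Proof.
move=> deg Sl; case: (posnP l) => [-> //|l0].
have [/existsP[i]|/existsPn grow] :=
  boolP [exists i : 'I_l, (0 < i)%N &&
           (\dim (Lspan i S) <= (\dim (Lspan i.-1 S)).+1)%N].
  move=> /andP[i0 di]; rewrite leq_max; apply/orP; left.
  have [|v ess_v vl] := ex_essential l0 (set_length_step Sl _); first by lia.
  have [|x [xS]] := essential_nseq _ di ess_v vl; first by rewrite i0 /=.
  rewrite size_nseq leqNgt => /negP xl; apply/negP => lt; apply: xl.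
  rewrite big_nseq -Monoid.iteropE /=.
  have xX j : (j <= l.-1)%N -> x ^+ j \in Lspan l.-1 S.
    move=> jl; have := @Lspan_mem _ _ l.-1 S (nseq j x); rewrite size_nseq.
    rewrite big_nseq -Monoid.iteropE /=; apply=> // y yj; apply: xS.
    by move: yj; rewrite !mem_nseq => /andP[_ ->]; rewrite l0.
  have [c xm] := deg x.
  (* As [m <= l], the factor [x ^+ m] of [x ^+ l] can be expanded, leaving only powers below [l]. *)
  rewrite -[iterop _ _ _ _]/(x ^+ l) -{1}(@subnK m l); last by lia.
  rewrite exprD xm mulr_sumr; apply: rpred_sum => j _.
  rewrite -scalerAr rpredZ // -exprD; apply: xX.
  by have := ltn_ord j; lia.
rewrite leq_max; apply/orP; right.
(* From dimension 1, each step below [l] adds at least 2; the step to [l] adds at least 1, which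
   gives [l.*2] in total. *)
have dimk k : (k < l)%N -> (k.*2 < \dim (Lspan k S))%N.
  elim: k => [_|k IH kl]; first by rewrite Lspan0 dimv1.
  have := grow (Ordinal kl); rewrite /= -ltnNge; have := IH (ltnW kl).
  by rewrite doubleS; lia.
have lt : (\dim (Lspan l.-1 S) < \dim (Lspan l S))%N.
  rewrite ltnNge; apply: contra (set_length_step Sl (k := l) _); last by lia.
  move=> le; rewrite (_ : Lspan l.-1 S = Lspan l S) ?subvv //.
  by apply/eqP; rewrite eqEdim Lspan_sub ?leq_pred.
have := dimk l.-1; have := dimvS (subvf (Lspan l S)); lia.
Qed.

End LengthBound.

(** * Dihedral relations between the two generators *)

Section CyclicAntidiag.
Variables (F : fieldType) (m : nat).

Let A : 'M[F]_m.+1 := cyclic_mx F m.+1.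
Let B : 'M[F]_m.+1 := antidiag_mx F m.+1.

Lemma cyclic_mx_mul (M : 'M[F]_m.+1) i j : (A * M) i j = M (ordS i) j.
Proof.
rewrite /A /cyclic_mx mulr_suml summxE (bigD1 i) //= big1 => [|k ki].
  by rewrite addr0 mxE (bigD1 (ordS i)) //= big1 => [|k kS];
    rewrite !mxE ?eqxx ?mul1r ?addr0 // (negbTE kS) andbF mul0r.
by rewrite mxE big1 // => t _; rewrite mxE eq_sym (negbTE ki) mul0r.
Qed.

Lemma antidiag_mx_mul (M : 'M[F]_m.+1) i j : (B * M) i j = M (rev_ord i) j.
Proof.
rewrite /B /antidiag_mx mulr_suml summxE (bigD1 i) //= big1 => [|k ki].
  by rewrite addr0 mxE (bigD1 (rev_ord i)) //= big1 => [|k kS];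
    rewrite !mxE ?eqxx ?mul1r ?addr0 // (negbTE kS) andbF mul0r.
by rewrite mxE big1 // => t _; rewrite mxE eq_sym (negbTE ki) mul0r.
Qed.

Lemma cyclic_mxX k i j : (A ^+ k) i j = (j == (i + k) %% m.+1 :> nat)%N%:R.
Proof.
elim: k i => [|k IH] i.
  by rewrite expr0 mxE addn0 modn_small // eq_sym.
by rewrite exprS cyclic_mx_mul IH /= modnDml addSnnS.
Qed.

Lemma cyclic_mx_expn : A ^+ m.+1 = 1.
Proof.
apply/matrixP => i j.
by rewrite cyclic_mxX modnDr modn_small // mxE eq_sym.
Qed.

Lemma antidiag_mxK : B * B = 1.
Proof.
apply/matrixP => i j; rewrite -[X in _ * X]mulr1 !antidiag_mx_mul rev_ordK.
by rewrite mxE.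
Qed.

(** [A * B] is a reflection, so its square is 1; multiply by the inverse [A ^+ m] of [A] on the left
    and by [B] on the right. *)
Lemma antidiag_cyclic_mx : B * A = A ^+ m * B.
Proof.
have rev_rev : A * B * (A * B) = 1.
  apply/matrixP => i j; rewrite -[X in _ * X]mulr1 -!mulrA.
  rewrite cyclic_mx_mul antidiag_mx_mul cyclic_mx_mul antidiag_mx_mul !mxE.
  congr (_ == _)%:R; apply/val_inj => /=.
  (* The successor wraps around only at [m], which [A * B] fixes. *)
  have [im|im] := ltnP i m.
    rewrite (@modn_small i.+1) //=.
    have -> : (m.+1 - i.+2).+1 = (m - i)%N by lia.
    by rewrite modn_small; lia.
  have -> : (i : nat) = m by have := ltn_ord i; lia.
  by rewrite modnn subn1 /= modnn subn1.
have := congr1 (fun M => A ^+ m * M * B) rev_rev.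
rewrite mulr1 !mulrA -exprSr cyclic_mx_expn mul1r.
by rewrite -[_ * B * B]mulrA antidiag_mxK mulr1.
Qed.

Lemma antidiag_cyclic_mxX k : B * A ^+ k = A ^+ (m * k) * B.
Proof.
elim: k => [|k IH]; first by rewrite muln0 mulr1 mul1r.
by rewrite exprSr mulrA IH -mulrA antidiag_cyclic_mx mulrA -exprD mulnSr.
Qed.

(** * Circulants and the dimension of the bicirculants *)

Definition circulants : {vspace 'M[F]_m.+1} :=
  <<[seq (A ^+ i)%R | i : 'I_m.+1]>>%VS.

Lemma cyclic_mxX_circulants k : A ^+ k \in circulants.
Proof.
rewrite -(expr_mod _ cyclic_mx_expn); apply: memv_span.
by apply/imageP; exists (Ordinal (ltn_pmod k (ltn0Sn m))).
Qed.

Lemma dim_circulants : (\dim circulants <= m.+1)%N.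
Proof. by rewrite (leq_trans (dim_span _)) // size_image card_ord. Qed.

Lemma sum_cyclic_mxX : \sum_(i < m.+1) A ^+ i = const_mx 1.
Proof.
apply/matrixP => i j; rewrite summxE mxE.
(* This is [j - i] modulo [m.+1], shifted to avoid truncated subtraction. *)
pose k : 'I_m.+1 := Ordinal (ltn_pmod (j + (m.+1 - i)) (ltn0Sn m)).
have kP (t : 'I_m.+1) : (j == (i + t) %% m.+1 :> nat)%N = (t == k).
  apply/eqP/eqP => [jE|->]; last first.
    rewrite /= modnDmr (_ : i + _ = j + m.+1)%N; last by have := ltn_ord i; lia.
    by rewrite modnDr modn_small.
  apply/val_inj; rewrite /= jE modnDml.
  rewrite (_ : i + t + _ = t + m.+1)%N; last by have := ltn_ord i; lia.
  by rewrite modnDr modn_small.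
under eq_bigr => t _ do rewrite cyclic_mxX kP.
by rewrite (bigD1 k) //= eqxx big1 ?addr0 // => t /negbTE ->.
Qed.

Lemma antidiag_mx_const : B * const_mx 1 = const_mx 1.
Proof. by apply/matrixP => i j; rewrite antidiag_mx_mul !mxE. Qed.

Lemma cyclic_mx_circulants : (<[A]> * circulants <= circulants)%VS.
Proof.
rewrite /circulants {1}span_def big_distrr /= big_map big_enum_cond /=.
apply/subv_sumP => i _; rewrite prodv_line -memvE -exprS.
exact: cyclic_mxX_circulants.
Qed.

Lemma antidiag_mx_circulants :
  (<[B]> * circulants <= circulants * <[B]>)%VS.
Proof.
rewrite {1}/circulants span_def big_distrr /= big_map big_enum_cond /=.
apply/subv_sumP => i _; rewrite prodv_line -memvE antidiag_cyclic_mxX.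
by rewrite memv_mul ?memv_line ?cyclic_mxX_circulants.
Qed.

(** The right-hand side contains 1 and is stable under left multiplication by [A] and [B]. *)
Lemma bicirculants_sub :
  (bicirculants F m.+1 <= circulants + circulants * <[B]>)%VS.
Proof.
have subBB : (circulants * <[B]> * <[B]> = circulants)%VS.
  by rewrite -prodvA prodv_line antidiag_mxK prodv1.
apply: agenv_sub_modl.
  by rewrite (subv_trans _ (addvSl _ _)) // -memvE (cyclic_mxX_circulants 0).
have gens : (<<[fset A; B]%fset>> <= <[A]> + <[B]>)%VS.
  apply/span_subvP => g; rewrite !inE => /orP[] /eqP ->.
    by rewrite (subvP (addvSl _ _)) ?memv_line.
  by rewrite (subvP (addvSr _ _)) ?memv_line.
rewrite (subv_trans (prodvSl _ gens)) // prodvDl !prodvDr !prodvA.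
(* The target is doubled, with [circulants] written once as [circulants * <[B]> * <[B]>], so that
   the four products are compared term by term. *)
rewrite [X in (_ <= X)%VS](_ : _ = (circulants + circulants * <[B]>) +
  (circulants * <[B]> + circulants * <[B]> * <[B]>))%VS; last first.
  by rewrite subBB [(_ * _ + circulants)%VS]addvC addvv.
by rewrite !addvS ?prodvSl ?cyclic_mx_circulants ?antidiag_mx_circulants.
Qed.

Lemma dim_bicirculants : (\dim (bicirculants F m.+1) <= m.*2.+1)%N.
Proof.
rewrite (leq_trans (dimvS bicirculants_sub)) //.
have cap : (0 < \dim (circulants :&: circulants * <[B]>))%N.
  rewrite lt0n dimv_eq0; apply/negP => /eqP cap0.
  (* For the second membership, the all-ones matrix is multiplied by [B], which fixes it, and [B] is
     moved to the right of each power of [A]. *)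
  have : const_mx 1 \in (circulants :&: circulants * <[B]>)%VS.
    rewrite memv_cap; apply/andP; split.
      rewrite -sum_cyclic_mxX rpred_sum // => i _.
      exact: cyclic_mxX_circulants.
    rewrite -antidiag_mx_const -sum_cyclic_mxX mulr_sumr rpred_sum // => i _.
    rewrite antidiag_cyclic_mxX memv_mul ?memv_line //.
    exact: cyclic_mxX_circulants.
  rewrite cap0 memv0 => /eqP/matrixP/(_ ord0 ord0)/eqP.
  by rewrite !mxE oner_eq0.
have := dimv_sum_cap circulants (circulants * <[B]>).
have := dim_prodv circulants <[B]>; have := dim_circulants.
have : (\dim <[B]> <= 1)%N by rewrite dim_vline; case: (_ != 0).
move: cap; move: (\dim (_ :&: _)) (\dim (_ + _)) (\dim (_ * _)).
move: (\dim circulants).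
by case: (\dim <[B]>) => [|[|//]] d a b c; rewrite ?muln0 ?muln1; lia.
Qed.

End CyclicAntidiag.

(** * The bicirculants as an algebra *)

Section BicirculantAlgebra.
Variables (F : fieldType) (m : nat).

Let A : 'M[F]_m.+1 := cyclic_mx F m.+1.
Let B : 'M[F]_m.+1 := antidiag_mx F m.+1.
Let alg := subvs_of (bicirculants F m.+1).

(** The unit of an [{aspace}] is in general only an idempotent; this one contains the identity
    matrix. *)
Lemma bicirculants_val1 : vsval (1 : alg) = 1.
Proof. by apply/eqP; rewrite algid_eq1 memvE sub1_agenv. Qed.

Lemma bicirculants_valX (x : alg) k : vsval (x ^+ k) = vsval x ^+ k.
Proof.
elim: k => [|k IH]; first by rewrite !expr0 bicirculants_val1.
by rewrite !exprS -IH.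
Qed.

Lemma bicirculants_degree (x : alg) :
  exists c : nat -> F, x ^+ m.+1 = \sum_(i < m.+1) c i *: x ^+ i.
Proof.
pose p := char_poly (vsval x); exists (fun i => - p`_i).
apply: val_inj; rewrite [LHS]bicirculants_valX linear_sum.
under eq_bigr => i _ do rewrite linearZ /= bicirculants_valX scaleNr.
have := Cayley_Hamilton (vsval x).
rewrite -/p -{1}[p]coefK poly_def size_char_poly.
rewrite linear_sum big_ord_recr /= linearZ /= rmorphXn /= horner_mx_X.
have /monicP := char_poly_monic (vsval x).
rewrite lead_coefE size_char_poly /= => ->; rewrite scale1r => /eqP.
rewrite addrC addr_eq0 => /eqP ->; rewrite -sumrN; apply: eq_bigr => i _.
by rewrite linearZ /= rmorphXn /= horner_mx_X.
Qed.

Lemma cyclic_mx_bicirculants : A \in bicirculants F m.+1.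
Proof.
by apply: (subvP (sub_agenv _)); apply: memv_span; rewrite !inE eqxx.
Qed.

Lemma antidiag_mx_bicirculants : B \in bicirculants F m.+1.
Proof.
by apply: (subvP (sub_agenv _)); apply: memv_span; rewrite !inE eqxx orbT.
Qed.

(** * Two generating reflections and the lower bound *)

Let b : alg := Subvs antidiag_mx_bicirculants.
Let c : alg := Subvs cyclic_mx_bicirculants * b.
Let S : {fset alg} := [fset b; c]%fset.

(** Because [B * B = 1], the matrix [A] is recovered as [c * b]. *)
Lemma reflections_generating : generating S.
Proof.
move=> a; apply/mem_agenv_Lspan.
have [i] := (mem_bicirculants (vsval a)).1 (subvsP a).
suff /subvP H : (Lspan i [fset A; B]%fset <= linfun vsval @: agenv <<S>>)%VS.
  by move/H/memv_imgP => [u uS]; rewrite lfunE /= => /val_inj ->.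
apply/Lspan_subP => w; elim: w {a} => [|x w IH] wS wi; last first.
  have /prodvP agM : (agenv <<S>> * agenv <<S>> <= agenv <<S>>)%VS.
    by rewrite agenvM subvv.
  have bS : b \in agenv <<S>>.
    by apply: (subvP (sub_agenv _)); apply: memv_span; exact: fset21.
  have cS : c \in agenv <<S>>.
    by apply: (subvP (sub_agenv _)); apply: memv_span; exact: fset22.
  have /memv_imgP[u uS] :
      \prod_(y <- w) y \in (linfun vsval @: agenv <<S>>)%VS.
    by apply: IH (ltnW wi) => y yw; apply: wS; rewrite inE yw orbT.
  rewrite big_cons lfunE /= => ->.
  have := wS x (mem_head _ _); rewrite !inE => /orP[] /eqP ->.
    apply/memv_imgP; exists (c * b * u); first exact: agM (agM _ _ cS bS) uS.
    by rewrite lfunE /= -[_ * B * B]mulrA antidiag_mxK mulr1.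
  by apply/memv_imgP; exists (b * u); rewrite ?lfunE //; exact: agM.
rewrite big_nil; apply/memv_imgP; exists 1.
  by rewrite memvE sub1_agenv.
by rewrite lfunE [RHS]bicirculants_val1.
Qed.

(* The position of the vertex i on the path m, 0, m-1, 1, .. whose edges are
   alternately the 2-cycles of B and of A * B. *)
Definition path_pos (i : nat) : nat := minn i.*2.+1 (m - i).*2.

(** Removing the first letter replaces row [i] by the row of its mirror image, at most one position
    away on the path. *)
Lemma path_pos_word (w : seq 'M[F]_m.+1) (i j : 'I_m.+1) :
  {subset w <= [:: B; A * B]} -> (\prod_(x <- w) x) i j != 0 ->
  (path_pos i <= path_pos j + size w)%N.
Proof.
elim: w i => [|x w IH] i wS.
  by rewrite big_nil mxE addn0; case: (i =P j) => [->|_] //; rewrite eqxx.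
rewrite big_cons /= addnS => nz.
have {}IH k : (\prod_(x <- w) x) k j != 0 ->
    (path_pos k <= path_pos j + size w)%N.
  by apply: IH => y yw; apply: wS; rewrite inE yw orbT.
move: (path_pos j + size w)%N IH nz => N IH; have im := ltn_ord i.
have := wS x (mem_head _ _); rewrite !inE => /orP[] /eqP ->.
  by rewrite antidiag_mx_mul => /IH; rewrite /path_pos /=; lia.
rewrite -mulrA cyclic_mx_mul antidiag_mx_mul => /IH; rewrite /path_pos /=.
have [ltim|leim] := ltnP i m; first by rewrite modn_small //; lia.
have -> : (i : nat) = m by lia.
by rewrite modnn; lia.
Qed.

Lemma reflections_length k : Lspan k S = fullv -> (m <= k)%N.
Proof.
move=> full; rewrite leqNgt; apply/negP => km.
(* For either parity of [m], the vertex [m./2] has position [m], while [ord_max] has position 0. *)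
have half : (m./2 < m.+1)%N by lia.
pose p : 'I_m.+1 := Ordinal half.
(* The entry at [p] and [ord_max], as a linear map: short words lie in its kernel. *)
pose f : 'Hom(alg, 'M[F]_1) := linfun (col ord_max \o (row p \o vsval)).
have fE u : f u = const_mx (vsval u p ord_max).
  by apply/matrixP => i j; rewrite lfunE !mxE.
have : (Lspan k S <= lker f)%VS.
  apply/Lspan_subP => w wS wk; rewrite memv_ker fE.
  have -> : vsval (\prod_(x <- w) x) = \prod_(M <- map vsval w) M.
    rewrite big_map; elim: (w) => [|x s IH].
      by rewrite !big_nil bicirculants_val1.
    by rewrite !big_cons -IH.
  have [->|/path_pos_word] := eqVneq ((\prod_(M <- map vsval w) M) p ord_max) 0.
    by apply/eqP/matrixP => i j; rewrite !mxE.
  suff sub : {subset map vsval w <= [:: B; A * B]}.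
    move/(_ sub); rewrite size_map /path_pos /=; move: wk.
    by move: (size w) => s; lia.
  move=> _ /mapP[x xw ->]; have /fset2P[->|->] := wS x xw.
    exact: mem_head.
  by rewrite inE mem_head orbT.
(* [A ^+ (m - p)] sends [p] to [m], so its entry there is 1. *)
rewrite full => /subvP/(_ (Subvs cyclic_mx_bicirculants ^+ (m - p)) (memvf _)).
rewrite memv_ker fE bicirculants_valX /= cyclic_mxX /= subnKC; last by lia.
rewrite modn_small // eqxx => /eqP/matrixP/(_ ord0 ord0)/eqP.
by rewrite !mxE oner_eq0.
Qed.

Lemma bicirculants_length : algebra_length alg m.
Proof.
have bound (T : {fset alg}) :
    generating T -> exists2 k, set_length T k & (k <= m)%N.
  move=> /generating_set_length[k Tk]; exists k => //.
  rewrite (leq_trans (set_length_bound bicirculants_degree Tk)) //.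
  rewrite geq_max leqnn.
  (* Half of [m.*2.+1] rounds down to [m]. *)
  by rewrite leq_half_double dimvf; exact: dim_bicirculants.
split=> //; exists S; first exact: reflections_generating.
have [k Sk km] := bound S reflections_generating.
have kE : k = m; last by rewrite kE in Sk.
by apply/eqP; rewrite eqn_leq km; case: Sk => /reflections_length.
Qed.

End BicirculantAlgebra.

Theorem theorem4p4 (F : fieldType) (n : nat) (hn : (0 < n)%N) :
  algebra_length (subvs_of (bicirculants F n)) (n - 1)%N.
Proof. by case: n hn => // m _; rewrite subn1; exact: bicirculants_length. Qed.
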